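(* Let $l \geq 1$ be an integer and run the reduction algorithm described in the context starting from $X_1(l) = X(l)$. Then for every $k \geq 1$ such that the sequence $X_k(l)$ is produced by the algorithm, $X_k(l)$ is $2^{n_k}$-simple for some positive integer $n_k$ (so that each step of the algorithm is well defined).
   Context: For integers $m \geq 1$ and $0 \leq l \leq m$ let $A_{l,m} = \frac{l!\, m!}{2^{m-l}} \sum_{k=l}^{m} 2^{k} \binom{2m-2k}{m-k}\binom{m+k}{m}\binom{k}{l}$ (these are integers; set $A_{0,0}=1$), and let $\nu_2$ denote the $2$-adic valuation. For $l \geq 0$ let $X(l)$ be the sequence $\big(\nu_2(A_{l,\,l+m-1})\big)_{m \geq 1}$. Operators on integer sequences: $F(a_1,a_2,a_3,\dots) = (a_1,a_1,a_2,a_3,\dots)$ and $T(a_1,a_2,a_3,\dots) = (a_1,a_3,a_5,a_7,\dots)$. Let $c = (\nu_2(m))_{m\geq 1} = (0,1,0,2,0,1,0,3,\dots)$. For an integer $s \geq 2$, a sequence $(a_j)_{j\geq 1}$ is called $s$-simple if $s$ is the largest integer such that $a_{st+1} = a_{st+2} = \cdots = a_{s(t+1)}$ for every $t \geq 0$. The reduction algorithm: set $X_1(l) = X(l)$. At cycle $k$, given $X_k(l)$, find $n_k \in \mathbb{N}$ such that $X_k(l)$ is $2^{n_k}$-simple; put $Y = T^{n_k}(X_k(l))$, $Z = Y - c$ (termwise difference), $W = F(Z)$. If $W$ is a constant sequence, stop; otherwise set $X_{k+1}(l) = W$ and perform the next cycle. *)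

(* Defs.v *)
From mathcomp Require Import all_boot all_order all_algebra.

Set Implicit Arguments.
Unset Strict Implicit.
Unset Printing Implicit Defensive.

Import Order.TTheory GRing.Theory Num.Theory.
Local Open Scope ring_scope.

(* Meaningful for [l <= m]; computed in [rat] so that the division by
   [2 ^ (m - l)] is exact.  [A 0 0] evaluates to 1. *)
Definition A (l m : nat) : rat :=
  (l`! * m`!)%N%:R / 2 ^+ (m - l)%N *
  \sum_(l <= k < m.+1)
     (2 ^ k * 'C(2 * m - 2 * k, m - k) * 'C(m + k, m) * 'C(k, l))%N%:R.

(* 2-adic valuation of a nonzero rational; junk value 0 at 0. *)
Definition nu2 (x : rat) : int :=
  (logn 2 `|numq x|%N)%:Z - (logn 2 `|denq x|%N)%:Z.

(* A sequence (a_1, a_2, a_3, ...) is represented by the function a with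
   a i = a_(i+1); all indices below are shifted accordingly. *)
Definition sequence := nat -> int.

Definition Xseq (l : nat) : sequence := fun i => nu2 (A l (l + i)).

Definition F (a : sequence) : sequence := fun i => a i.-1.

Definition T (a : sequence) : sequence := fun i => a (2 * i)%N.

Definition c : sequence := fun i => nu2 i.+1%:R.

Definition sub_termwise (a b : sequence) : sequence := fun i => a i - b i.

Definition block_constant (s : nat) (a : sequence) : Prop :=
  forall t i : nat, (i < s)%N -> a (s * t + i)%N = a (s * t)%N.

Definition simple (s : nat) (a : sequence) : Prop :=
  [/\ (2 <= s)%N,
      block_constant s a
    & forall s' : nat, block_constant s' a -> (s' <= s)%N].

Definition constant_sequence (a : sequence) : Prop :=
  exists z : int, forall i : nat, a i = z.

Definition cycle_output (n : nat) (X : sequence) : sequence :=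
  F (sub_termwise (iter n T X) c).

(* [produced l k X]: the algorithm started from [Xseq l] reaches cycle [k],
   and [X] is the sequence X_k(l) that this cycle starts from. *)
Inductive produced (l : nat) : nat -> sequence -> Prop :=
| produced_init : produced l 1 (Xseq l)
| produced_next (k n : nat) (X : sequence) :
    produced l k X ->
    simple (2 ^ n) X ->
    ~ constant_sequence (cycle_output n X) ->
    produced l k.+1 (cycle_output n X).

(* Main.v *)
Require Import Defs.
From mathcomp Require Import all_boot all_order all_algebra.
From mathcomp Require Import ring zify.

(** The sum defining [A l m] is, up to elementary factors, the [l]-th factorial
    moment of the weights [2^k 'C(2m-2k, m-k) 'C(m+k, m)]. A first-order
    recurrence for the weights makes the moments satisfy a three-term recurrence
    in [l], which is solved downwards from [l = m]: with [i = m - l] this gives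
    [A l m = 2^l (i+1)(i+2)...(i+2l) b_i], where [b_0 = 1] and
    [b_(i+1) = (2m+1) b_i - i (2m+1-i) b_(i-1)]. The last coefficient is even,
    so every [b_i] is odd.

    Hence [X(l)] has the form [i |-> z + nu2 ((i+1)...(i+r))] with [r = 2l]. If
    [r = 2^n q] with [q] odd, such a sequence is [2^n]-simple, and one cycle of
    the algorithm turns it into a sequence of the same form with [r] replaced by
    the even number [q - 1]; the new sequence is constant when [q = 1]. *)

Set Implicit Arguments.
Unset Strict Implicit.
Unset Printing Implicit Defensive.

Import GRing.Theory Num.Theory.
Local Open Scope ring_scope.

Definition weight (m k : nat) : nat :=
  (2 ^ k * 'C(2 * m - 2 * k, m - k) * 'C(m + k, m))%N.

Definition factorial_moment (m l : nat) : int :=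
  \sum_(k < m.+1) (weight m k * k ^_ l)%N%:Z.

Lemma central_binS n :
  (n.+1 * 'C(2 * n.+1, n.+1) = 2 * (2 * n).+1 * 'C(2 * n, n))%N.
Proof.
have pascal_diag := mul_bin_diag (2 * n).+2 n.
have pascal_down := mul_bin_down (2 * n).+1 n.
have top_sub : ((2 * n).+1 - n = n.+1)%N by lia.
rewrite /= top_sub in pascal_down; rewrite /= in pascal_diag.
have -> : (2 * n.+1 = (2 * n).+2)%N by lia.
by rewrite -pascal_diag -mulnA pascal_down; nia.
Qed.

Lemma weightS m k : (k < m)%N ->
  (k.+1 * (2 * (m - k)).-1 * weight m k.+1
   = (m + k.+1) * (m - k) * weight m k)%N.
Proof.
move=> lt_km; have /= pascal := mul_bin_down (m + k.+1) m.
rewrite addKn addnS /= in pascal.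
have [n m_def] : exists n, m = (n + k.+1)%N by exists (m - k.+1)%N; lia.
have mk : (m - k = n.+1)%N by lia.
have mk2 : (2 * m - 2 * k = 2 * n.+1)%N by lia.
have mkS2 : (2 * m - 2 * k.+1 = 2 * n)%N by lia.
have mkS : (m - k.+1 = n)%N by lia.
have n2 : (2 * n.+1).-1 = (2 * n).+1 by lia.
rewrite /weight mk mk2 mkS2 mkS n2 expnS addnS.
transitivity ((2 * (2 * n).+1 * 'C(2 * n, n)) * (k.+1 * 'C((m + k).+1, m))
              * 2 ^ k)%N; first by ring.
by rewrite -central_binS -pascal; ring.
Qed.

(* Summation of [weightS] against [k ^_ l]. *)
Lemma factorial_moment_shift m l :
  \sum_(k < m.+1) (m%:Z + k%:Z + 1) * (m%:Z - k%:Z) * (weight m k * k ^_ l)%N%:Z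
  = \sum_(k < m.+1)
      (2 * m%:Z - 2 * k%:Z + 1) * (weight m k * k ^_ l.+1)%N%:Z :> int.
Proof.
rewrite big_ord_recr /= subrr mulr0 mul0r addr0.
rewrite big_ord_recl /= ffact0n muln0 mulr0 add0r.
apply: eq_bigr => k _; rewrite /bump /= add1n ffactSS.
have lt_km := ltn_ord k; have /(congr1 Posz) := weightS lt_km.
rewrite !PoszM.
have -> : (2 * (m - k)).-1%:Z = 2 * m%:Z - 2 * k.+1%:Z + 1 :> int by lia.
have -> : (m - k)%:Z = m%:Z - k%:Z :> int by lia.
have -> : (m + k.+1)%:Z = m%:Z + k%:Z + 1 :> int by lia.
by move=> weight_rec; rewrite mulrA -weight_rec; ring.
Qed.

Lemma ffactnSz k l : (k ^_ l.+1)%:Z = (k%:Z - l%:Z) * (k ^_ l)%:Z :> int.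
Proof.
rewrite ffactnSr; have [le_lk|lt_kl] := leqP l k; first by rewrite PoszM; nia.
by rewrite ffact_small // mulr0.
Qed.

Lemma factorial_moment_rec m l :
  (m%:Z - l%:Z) * (m%:Z + l%:Z + 1) * factorial_moment m l
  = (2 * m%:Z + 1) * factorial_moment m l.+1 - factorial_moment m l.+2.
Proof.
apply/eqP; rewrite -subr_eq0; apply/eqP.
have /eqP := factorial_moment_shift m l; rewrite -subr_eq0 => /eqP shift.
rewrite -[RHS]shift /factorial_moment !mulr_sumr -!sumrB.
apply: eq_bigr => k _; rewrite !(PoszM (weight m k)) !ffactnSz.
have -> : l.+1%:Z = l%:Z + 1 :> int by lia.
by ring.
Qed.

Lemma factorial_moment_diag m :
  factorial_moment m m * m`!%:Z = (2 ^ m)%N%:Z * (m + m)`!%:Z.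
Proof.
rewrite /factorial_moment big_ord_recr /= big1 ?add0r => [|k _]; last first.
  by rewrite ffact_small ?ltn_ord // muln0.
rewrite ffactnn /weight !subnn bin0 muln1 -!PoszM; congr Posz.
by have := bin_fact (leq_addr m m); rewrite addnK => <-; ring.
Qed.

Lemma factorial_moment_gt m l : (m < l)%N -> factorial_moment m l = 0.
Proof.
move=> lt_ml; rewrite /factorial_moment big1 // => k _.
by rewrite ffact_small ?muln0 // (leq_trans (ltn_ord k)).
Qed.

(* At [i = 0] the junk value of [i.-1] is harmless: its coefficient vanishes. *)
Fixpoint moment_factor (N : int) (j : nat) : int :=
  if j is i.+1
  then N * moment_factor N i - i%:Z * (N - i%:Z) * moment_factor N i.-1
  else 1.

Lemma odd_absz_moment_factor N j : odd `|N| -> odd `|moment_factor N j|.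
Proof.
have odd_sub (x y : int) : odd `|x - y| = odd `|x| (+) odd `|y| by lia.
move=> odd_N; elim/ltn_ind: j => -[|j] // IHj.
rewrite /= odd_sub !abszM !oddM odd_sub odd_N IHj //=.
by case: (odd j).
Qed.

Lemma factorial_moment_factor m l j : (l + j = m)%N ->
  factorial_moment m l * (m`! * j`!)%N%:Z
  = (2 ^ m * (m + l)`!)%N%:Z * moment_factor (2 * m%:Z + 1) j.
Proof.
pose N := 2 * m%:Z + 1; move=> m_def.
suff [] :
    factorial_moment m l * (m`! * j`!)%N%:Z
      = (2 ^ m * (m + l)`!)%N%:Z * moment_factor N j
  /\ factorial_moment m l.+1 * (m`! * j`!)%N%:Z
      = (2 ^ m * (m + l.+1)`!)%N%:Z * (j%:Z * moment_factor N j.-1) by [].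
elim: j l m_def => [|j IHj] l; rewrite ?addn0 => m_def.
  rewrite m_def [factorial_moment _ m.+1]factorial_moment_gt //.
  by rewrite fact0 muln1 mulr1 factorial_moment_diag PoszM !mul0r mulr0.
have [|moment1 moment2] := IHj l.+1; first by rewrite addSnnS.
split; last by rewrite factS mulnCA PoszM mulrCA moment1 mulrCA.
have top_neq0 : (m + l.+1)%:Z != 0 :> int by lia.
apply: (mulfI top_neq0).
transitivity ((m%:Z - l%:Z) * (m%:Z + l%:Z + 1) * factorial_moment m l
              * (m`! * j`!)%N%:Z).
  rewrite factS !PoszM.
  have -> : j.+1%:Z = m%:Z - l%:Z :> int by lia.
  have -> : (m + l.+1)%:Z = m%:Z + l%:Z + 1 :> int by lia.
  by ring.
rewrite factorial_moment_rec mulrBl -mulrA moment1 moment2 !addnS !factS /=.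
rewrite !PoszM -/N.
have -> : (m + l).+2%:Z = N - j%:Z by rewrite /N; lia.
by ring.
Qed.

Lemma A_factorial_moment l i :
  A l (l + i) * (2 ^ i)%N%:R
  = (factorial_moment (l + i) l * (l + i)`!%:Z)%:~R.
Proof.
set m := (l + i)%N.
have drop_low_terms : \sum_(l <= k < m.+1) (weight m k * 'C(k, l))%N%:R
    = \sum_(k < m.+1) (weight m k * 'C(k, l))%N%:R :> rat.
  rewrite -(big_mkord xpredT (fun k => (weight m k * 'C(k, l))%N%:R)).
  rewrite [RHS](big_cat_nat (n := l)) /= ?leqW ?leq_addr //.
  rewrite [X in _ = X + _]big_nat [X in _ = X + _]big1 ?add0r // => k.
  by case/andP=> _ lt_kl; rewrite bin_small ?muln0.
rewrite /A -/(weight m _) drop_low_terms addKn natrX mulrAC divfK ?expf_neq0 //.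
rewrite intrM /factorial_moment rmorph_sum /= mulr_suml mulr_sumr.
by apply: eq_bigr => k _; rewrite -!natrM -bin_ffact; congr (_%:R); ring.
Qed.

Lemma A_closed_form l i :
  A l (l + i) = ((2 ^ l * (i + 2 * l) ^_ (2 * l))%N%:Z
                 * moment_factor (2 * (l + i)%N%:Z + 1) i)%:~R.
Proof.
set m := (l + i)%N; set b := moment_factor _ i.
have clear_neq0 : (2 ^ i * i`!)%N%:R != 0 :> rat.
  by rewrite pnatr_eq0 muln_eq0 expn_eq0 -!lt0n fact_gt0.
apply: (mulIf clear_neq0).
rewrite natrM mulrA A_factorial_moment -[i`!%:R]/(i`!%:Z%:~R) -!intrM.
rewrite -mulrA -PoszM (factorial_moment_factor (erefl m)) -/b.
have := ffact_fact (leq_addl i (2 * l)); rewrite addnK => fact_top.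
have -> : (m + l = i + 2 * l)%N by rewrite /m; lia.
by rewrite -fact_top expnD !PoszM !intrM; ring.
Qed.

Lemma logn2_odd n : odd n -> logn 2 n = 0%N.
Proof. by rewrite -coprime2n; apply: logn_coprime. Qed.

Lemma nu2_int (x : int) : nu2 x%:~R = (logn 2 `|x|)%:Z.
Proof. by rewrite /nu2 numq_int denq_int logn1 subr0. Qed.

Section FactorialValuation.

Variable p : nat.
Hypothesis p_pr : prime p.

Lemma logn_addl n a b :
  (p ^ n %| a)%N -> (0 < b < p ^ n)%N -> logn p (a + b) = logn p b.
Proof.
move=> dvd_a /andP[b_gt0 lt_b].
have sum_gt0 : (0 < a + b)%N by rewrite addn_gt0 b_gt0 orbT.
have lt_log : (logn p b < n)%N.
  rewrite -(ltn_exp2l _ _ (prime_gt1 p_pr)) (leq_ltn_trans _ lt_b) //.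
  exact: dvdn_leq b_gt0 (pfactor_dvdnn p b).
have dvd_sub e : (e <= n)%N -> (p ^ e %| a)%N.
  by move=> le_en; apply: dvdn_trans (dvdn_exp2l p le_en) dvd_a.
apply/eqP; rewrite eqn_leq leqNgt -!pfactor_dvdn //.
rewrite (dvdn_addr _ (dvd_sub _ lt_log)).
rewrite (dvdn_addr _ (dvd_sub _ (ltnW lt_log))).
by rewrite !pfactor_dvdn // ltnn leqnn.
Qed.

Lemma logn_factS n : logn p n.+1`! = (logn p n.+1 + logn p n`!)%N.
Proof. by rewrite factS lognM // fact_gt0. Qed.

Lemma logn_fact_add n a j : (p ^ n %| a)%N -> (j < p ^ n)%N ->
  logn p (a + j)`! = (logn p a`! + logn p j`!)%N.
Proof.
move=> dvd_a; elim: j => [|j IHj] lt_j; first by rewrite fact0 logn1 !addn0.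
rewrite addnS !logn_factS IHj 1?ltnW // -addnS (logn_addl dvd_a) //.
by rewrite addnCA.
Qed.

Lemma logn_fact_mulX n t :
  logn p (p ^ n * t)`! = (logn p t`! + t * logn p (p ^ n)`!)%N.
Proof.
elim: t => [|t IHt]; first by rewrite muln0 mul0n addn0.
have pn_gt0 : (0 < p ^ n)%N by rewrite expn_gt0 prime_gt0.
have top_logn : logn p (p ^ n)`! = (n + logn p (p ^ n).-1`!)%N.
  by rewrite -{1}(prednK pn_gt0) logn_factS prednK // pfactorK.
have top_def : (p ^ n * t.+1 = (p ^ n * t + (p ^ n).-1).+1)%N by lia.
rewrite top_def logn_factS -top_def lognM // pfactorK //.
rewrite (logn_fact_add (dvdn_mulr t (dvdnn _))) ?ltn_predL //.
by rewrite IHt logn_factS top_logn; lia.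
Qed.

Lemma logn_ffact_block n q t j : (j < p ^ n)%N ->
  logn p ((p ^ n * t + j + p ^ n * q) ^_ (p ^ n * q))
  = (logn p ((t + q) ^_ q) + q * logn p (p ^ n)`!)%N.
Proof.
have logn_ffactK i r :
    (logn p ((i + r) ^_ r) + logn p i`! = logn p (i + r)`!)%N.
  have <- := ffact_fact (leq_addl i r).
  by rewrite addnK lognM ?ffact_gt0 ?leq_addl ?fact_gt0.
move=> lt_j; apply/eqP; rewrite -(eqn_add2r (logn p (p ^ n * t + j)`!)).
rewrite logn_ffactK addnAC -mulnDr !(@logn_fact_add n) ?dvdn_mulr //.
by rewrite !logn_fact_mulX -logn_ffactK; apply/eqP; ring.
Qed.

End FactorialValuation.

Lemma block_constant_simple s (a : sequence) :
  (2 <= s)%N -> block_constant s a -> a s <> a 0%N -> simple s a.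
Proof.
move=> s_ge2 block_s a_s; split=> // s' block_s'; rewrite leqNgt; apply/negP.
by move=> lt_s; apply: a_s; rewrite -[s]add0n -(muln0 s') block_s' // muln0.
Qed.

Lemma simple_uniq s s' a : simple s a -> simple s' a -> s = s'.
Proof.
move=> [_ block max] [_ block' max'].
by apply/eqP; rewrite eqn_leq max // max'.
Qed.

Lemma iter_T n (a : sequence) i : iter n T a i = a (2 ^ n * i)%N.
Proof.
elim: n i => [|n IHn] i /=; first by rewrite mul1n.
by rewrite /T IHn mulnA expnSr.
Qed.

Definition rising_nu2 (r : nat) (z : int) : sequence :=
  fun i => z + (logn 2 ((i + r) ^_ r))%:Z.

Lemma rising_nu2_block n q z t j : (j < 2 ^ n)%N ->
  rising_nu2 (2 ^ n * q) z (2 ^ n * t + j)%N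
  = rising_nu2 q (z + (q * logn 2 (2 ^ n)`!)%N%:Z) t.
Proof. by move=> lt_j; rewrite /rising_nu2 logn_ffact_block //; lia. Qed.

Lemma iter_T_rising_nu2 n q z :
  iter n T (rising_nu2 (2 ^ n * q) z)
  =1 rising_nu2 q (z + (q * logn 2 (2 ^ n)`!)%N%:Z).
Proof.
by move=> i; rewrite iter_T -[(_ * i)%N]addn0 rising_nu2_block ?expn_gt0.
Qed.

Lemma rising_nu2_1_neq_0 q z : odd q -> rising_nu2 q z 1 <> rising_nu2 q z 0.
Proof.
move=> odd_q; rewrite /rising_nu2 add0n ffactnn add1n.
have -> : (q.+1 ^_ q = q.+1`!)%N by rewrite -ffactnn ffactnSr subSnn muln1.
have : (0 < logn 2 q.+1)%N by rewrite logn_gt0 mem_primes /= dvdn2 /= odd_q.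
by rewrite logn_factS //; lia.
Qed.

Lemma simple_rising_nu2 n q z X : (0 < n)%N -> odd q ->
  X =1 rising_nu2 (2 ^ n * q) z -> simple (2 ^ n) X.
Proof.
move=> n_gt0 odd_q X_rising.
have X_block t j : (j < 2 ^ n)%N -> X (2 ^ n * t + j)%N
    = rising_nu2 q (z + (q * logn 2 (2 ^ n)`!)%N%:Z) t.
  by move=> lt_j; rewrite X_rising rising_nu2_block.
have pow_gt0 : (0 < 2 ^ n)%N by rewrite expn_gt0.
apply: block_constant_simple; first by rewrite -{1}(expn1 2) leq_exp2l.
  by move=> t j lt_j; rewrite -[(_ * t)%N in RHS]addn0 !X_block.
have := X_block 1%N _ pow_gt0; have := X_block 0%N _ pow_gt0.
rewrite muln0 muln1 !addn0 => -> ->; exact: rising_nu2_1_neq_0.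
Qed.

Lemma F_sub_c_rising_nu2 q z : odd q ->
  F (sub_termwise (rising_nu2 q z) c) =1 rising_nu2 q.-1 z.
Proof.
case: q => // q odd_qS [|i]; rewrite /F /sub_termwise /rising_nu2 /c.
  by rewrite !add0n !ffactnn logn_factS // (logn2_odd odd_qS) (nu2_int 1) subr0.
rewrite (nu2_int i.+1) /= ffactnSr addnS -addSn addnK lognM //; first by lia.
by rewrite ffact_gt0 leq_addl.
Qed.

Lemma cycle_output_rising_nu2 n q z X : odd q ->
  X =1 rising_nu2 (2 ^ n * q) z ->
  cycle_output n X =1 rising_nu2 q.-1 (z + (q * logn 2 (2 ^ n)`!)%N%:Z).
Proof.
move=> odd_q X_rising i; rewrite -F_sub_c_rising_nu2 //.
by rewrite /cycle_output /F /sub_termwise -iter_T_rising_nu2 !iter_T X_rising.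
Qed.

Lemma Xseq_rising_nu2 l : Xseq l =1 rising_nu2 (2 * l) l%:Z.
Proof.
move=> i; rewrite /Xseq A_closed_form nu2_int abszM absz_nat.
have odd_factor : odd `|moment_factor (2 * (l + i)%N%:Z + 1) i|.
  by apply: odd_absz_moment_factor; lia.
have ffact_pos : (0 < (i + 2 * l) ^_ (2 * l))%N by rewrite ffact_gt0 leq_addl.
rewrite !lognM ?muln_gt0 ?expn_gt0 ?(odd_gt0 odd_factor) // pfactorK //.
by rewrite (logn2_odd odd_factor) addn0 PoszD.
Qed.

Lemma even_exp2_odd r : (0 < r)%N -> ~~ odd r ->
  exists n q, [/\ (0 < n)%N, odd q & r = (2 ^ n * q)%N].
Proof.
move=> r_gt0 even_r; have [q] := pfactor_coprime (isT : prime 2) r_gt0.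
rewrite coprime2n => odd_q r_def.
exists (logn 2 r), q; split=> //; last by rewrite mulnC.
by rewrite logn_gt0 mem_primes r_gt0 dvdn2.
Qed.

Lemma produced_rising_nu2 l k X : (1 <= l)%N -> produced l k X ->
  exists n q z, [/\ (0 < n)%N, odd q & X =1 rising_nu2 (2 ^ n * q) z].
Proof.
move=> l_gt0; elim=> [|{}k n {}X _ [n' [q [z [n_gt0 odd_q X_rising]]]]].
  have [||n [q [n_gt0 odd_q r_def]]] := @even_exp2_odd (2 * l); [lia..|].
  by exists n, q, l%:Z; split=> //; rewrite -r_def; apply: Xseq_rising_nu2.
move=> simple_X nonconstant.
have /eqP := simple_uniq simple_X (simple_rising_nu2 n_gt0 odd_q X_rising).
rewrite eqn_exp2l // => /eqP n_def; rewrite -{n'}n_def in X_rising n_gt0.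
have := cycle_output_rising_nu2 odd_q X_rising; set z' := z + _ => W_rising.
have [q1|q_neq1] := eqVneq q 1%N.
  case: nonconstant; exists z' => i.
  by rewrite W_rising q1 /rising_nu2 logn1 addr0.
have [||n' [q' [n'_gt0 odd_q' r_def]]] := @even_exp2_odd q.-1; [lia..|].
by exists n', q', z'; split=> //; rewrite -r_def.
Qed.

Theorem theorem1p3 (l : nat) (hl : (1 <= l)%N) (k : nat) (hk : (1 <= k)%N)
    (X : sequence) (hX : produced l k X) :
  exists n : nat, (0 < n)%N /\ simple (2 ^ n) X.
Proof.
have [n [q [z [n_gt0 odd_q X_rising]]]] := produced_rising_nu2 hl hX.
by exists n; split=> //; apply: simple_rising_nu2 n_gt0 odd_q X_rising.
Qed.
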